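(* Let $X$ be a set of (finite) permutations. If $X$ is labelled well-quasi-ordered (lwqo), then its downward closure $$X^{\le}=\{\sigma : \sigma\le\pi \text{ for some } \pi\in X\}$$ is also lwqo.
   Context: A permutation of length $n$ is an arrangement $\pi=\pi(1)\cdots\pi(n)$ of $1,\dots,n$ (the empty permutation is allowed). The permutation $\sigma$ of length $k$ is contained in $\pi$ of length $n$, written $\sigma\le\pi$, if there are indices $1\le i_1<\cdots<i_k\le n$ such that $\pi(i_1)\cdots\pi(i_k)$ is order isomorphic to $\sigma$ (its terms are in the same relative order as those of $\sigma$). A quasi-order $(Y,\le)$ is well-quasi-ordered (wqo) if every infinite sequence $y_1,y_2,\dots$ in $Y$ has indices $i<j$ with $y_i\le y_j$. Given a quasi-order $(L,\le_L)$, an $L$-labelled permutation is a pair $(\pi,\ell_\pi)$ with $\pi$ a permutation of length $n$ and $\ell_\pi:\{1,\dots,n\}\to L$. We say $(\sigma,\ell_\sigma)\le(\pi,\ell_\pi)$, where $\sigma$ and $\pi$ have lengths $k$ and $n$, if there are indices $1\le i_1<\cdots<i_k\le n$ such that $\pi(i_1)\cdots\pi(i_k)$ is order isomorphic to $\sigma$ and $\ell_\sigma(j)\le_L\ell_\pi(i_j)$ for all $1\le j\le k$. For a set $X$ of permutations, $X\wr L$ is the set of all $L$-labelled members of $X$ under this order. The set $X$ is labelled well-quasi-ordered (lwqo) if $X\wr L$ is wqo for every wqo $(L,\le_L)$. *)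

(* Defs.v *)
From Corelib Require Export RelationClasses.
From mathcomp Require Export all_boot all_fingroup.
Set Implicit Arguments.
Unset Strict Implicit.
Unset Printing Implicit Defensive.

(* A permutation of any length, the empty one included; positions and values
   are numbered from 0. *)
Record permutation : Type := Permutation {
  plen : nat;
  pval :> {perm 'I_plen}
}.

(* [e] gives the indices of a subsequence of [p] order isomorphic to [s]. *)
Definition occurrence (s p : permutation) (e : 'I_(plen s) -> 'I_(plen p)) :
    Prop :=
  (forall i j : 'I_(plen s), i < j -> e i < e j) /\
  (forall i j : 'I_(plen s), (s i < s j) = (p (e i) < p (e j))).

Definition contained (s p : permutation) : Prop :=
  exists e : 'I_(plen s) -> 'I_(plen p), occurrence e.

Definition down_closure (X : permutation -> Prop) (s : permutation) : Prop :=
  exists2 p : permutation, X p & contained s p.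

Definition wqo (Y : Type) (le : Y -> Y -> Prop) : Prop :=
  PreOrder le /\
  forall y : nat -> Y, exists i j : nat, i < j /\ le (y i) (y j).

Record labelled (X : permutation -> Prop) (L : Type) : Type := Labelled {
  lperm : permutation;
  lperm_in : X lperm;
  label : 'I_(plen lperm) -> L
}.

Arguments label {X L} _ _.

Definition labelled_le (X : permutation -> Prop) (L : Type)
    (leL : L -> L -> Prop) (a b : labelled X L) : Prop :=
  exists e : 'I_(plen (lperm a)) -> 'I_(plen (lperm b)),
    occurrence e /\
    forall j : 'I_(plen (lperm a)), leL (label a j) (label b (e j)).

Definition lwqo (X : permutation -> Prop) : Prop :=
  forall (L : Type) (leL : L -> L -> Prop),
    wqo leL -> wqo (@labelled_le X L leL).

(* Main.v *)
(* Fix an occurrence of each labelled member of the downward closure inside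
   some member of X, copy the labels along it, and give all other positions a
   new bottom label.  An embedding between two of these extended labelled
   permutations cannot send a position with an old label to one with the bottom
   label, so it restricts to an embedding between the original ones. *)
From Stdlib Require Import IndefiniteDescription.
Require Import Defs.

Lemma occurrence_id (p : permutation) :
  @occurrence p p (fun i : 'I_(plen p) => i).
Proof. by []. Qed.

Lemma occurrence_comp {s p q : permutation} {e : 'I_(plen s) -> 'I_(plen p)}
    {f : 'I_(plen p) -> 'I_(plen q)} :
  occurrence e -> occurrence f -> occurrence (f \o e).
Proof.
move=> [ltE valE] [ltF valF]; split=> i j /=; last by rewrite valE valF.
by move/ltE/ltF.
Qed.

(** By trichotomy, a strictly increasing map on a linear order also reflects the order. *)
Lemma occurrence_ltE {s p : permutation} {e : 'I_(plen s) -> 'I_(plen p)} :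
  occurrence e -> forall i j, (e i < e j) = (i < j).
Proof.
case=> ltE _ i j; case: (ltngtP i j) => [/ltE //| /ltE ltji | /val_inj ->].
  by rewrite ltnNge ltnW.
by rewrite ltnn.
Qed.

Lemma occurrence_inj {s p : permutation} {e : 'I_(plen s) -> 'I_(plen p)} :
  occurrence e -> injective e.
Proof.
move=> occE i j eqE; apply: val_inj.
have := occurrence_ltE occE i j; have := occurrence_ltE occE j i.
by rewrite eqE ltnn; case: ltngtP.
Qed.

(** Since [e] preserves and reflects the orders of positions and of values, it can be cancelled from
    both conditions on [h]. *)
Lemma occurrence_factor {s t q : permutation} {e : 'I_(plen t) -> 'I_(plen q)}
    {h : 'I_(plen s) -> 'I_(plen q)} {g : 'I_(plen s) -> 'I_(plen t)} :
  occurrence e -> occurrence h -> (forall i, e (g i) = h i) -> occurrence g.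
Proof.
move=> occE [ltH valH] egh; split=> i j.
  by move/ltH; rewrite -!egh (occurrence_ltE occE).
by rewrite valH -!egh -(proj2 occE).
Qed.

Lemma labelled_le_preorder {X : permutation -> Prop} {L : Type}
    {leL : L -> L -> Prop} :
  PreOrder leL -> PreOrder (@labelled_le X L leL).
Proof.
case=> reflL transL; split.
  by move=> a; exists (fun i => i); split=> [|j]; [exact: occurrence_id |].
move=> a b c [e [occE leE]] [f [occF leF]].
exists (f \o e); split; first exact: occurrence_comp.
by move=> j; apply: transL (leE j) (leF (e j)).
Qed.

Definition option_le {L : Type} (leL : L -> L -> Prop) (x y : option L) : Prop :=
  match x, y with
  | None, _ => True
  | Some _, None => False
  | Some a, Some b => leL a b
  end.

Lemma option_le_wqo {L : Type} {leL : L -> L -> Prop} :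
  wqo leL -> wqo (option_le leL).
Proof.
case=> [[reflL transL] goodL]; split.
  split=> [[a|] | [a|] [b|] [c|]] //=; exact: transL.
(* A [None] anywhere lies below the next term. If [y 0] is not [None], its label [a] is the default
   that turns [y] into a sequence in [L]; a pair found there that involves the default is replaced
   by such a neighbouring pair. *)
move=> y; case y0: (y 0) => [a|]; last by exists 0, 1; rewrite y0.
have [i [j [ltij]]] := goodL (fun n => odflt a (y n)).
case yi: (y i) => [b|]; last by exists i, i.+1; rewrite yi.
case yj: (y j) => [c|] /= lebc; last by exists j, j.+1; rewrite yj.
by exists i, j; rewrite yi yj.
Qed.

Definition push_label {L : Type} {m n : nat} (e : 'I_m -> 'I_n) (l : 'I_m -> L)
    (i : 'I_n) : option L :=
  omap l [pick j | e j == i].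

Lemma push_label_inj {L : Type} {m n : nat} {e : 'I_m -> 'I_n} (l : 'I_m -> L) :
  injective e -> forall j, push_label e l (e j) = Some (l j).
Proof.
move=> injE j; rewrite /push_label; case: pickP => [k /eqP/injE -> //|/(_ j)].
by rewrite eqxx.
Qed.

Lemma push_label_some {L : Type} {m n : nat} {e : 'I_m -> 'I_n} {l : 'I_m -> L}
    {i : 'I_n} {a : L} :
  push_label e l i = Some a -> exists2 j, e j = i & l j = a.
Proof.
by rewrite /push_label; case: pickP => //= k /eqP eki [<-]; exists k.
Qed.

(** The witnesses of membership in the downward closure, as data in [Type], so that a labelled
    permutation can be built from them. *)
Record hosted (X : permutation -> Prop) (s : permutation) : Type := Hosted {
  host : permutation;
  host_in : X host;
  host_emb : 'I_(plen s) -> 'I_(plen host);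
  host_occ : occurrence host_emb
}.

Arguments host {X s}.
Arguments host_in {X s}.
Arguments host_emb {X s}.
Arguments host_occ {X s}.

Lemma down_closure_hosted {X : permutation -> Prop} {s : permutation} :
  down_closure X s -> hosted X s.
Proof.
move=> down_s.
have /constructive_indefinite_description[p [Xp]] :
    exists p, X p /\ contained s p by case: down_s => p; exists p.
by move=> /constructive_indefinite_description[e occE]; exists p e.
Qed.

Definition host_labelled {X : permutation -> Prop} {L : Type}
    {a : labelled (down_closure X) L} (h : hosted X (lperm a)) :
    labelled X (option L) :=
  Labelled (host_in h) (push_label (host_emb h) (label a)).

Lemma host_labelled_le {X : permutation -> Prop} {L : Type}
    {leL : L -> L -> Prop} {a b : labelled (down_closure X) L}
    {h : hosted X (lperm a)} {k : hosted X (lperm b)} :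
  labelled_le (option_le leL) (host_labelled h) (host_labelled k) ->
  labelled_le leL a b.
Proof.
case=> f [/= occF leF].
(* The host position of [i] carries a [Some] label, so its image under [f] does too and hence lies
   in the range of [host_emb k]. *)
have restrict i : exists j,
    host_emb k j = f (host_emb h i) /\ leL (label a i) (label b j).
  move: (leF (host_emb h i)).
  rewrite push_label_inj; last exact: occurrence_inj (host_occ h).
  case lab: (push_label _ _ _) => [c|] //= leac.
  by have [j ej lj] := push_label_some lab; exists j; rewrite lj.
(* Choice over the finitely many positions gives [g] with [host_emb k (g i) = f (host_emb h i)], the
   factorization needed below. *)
have [g gP] := fin_all_exists restrict.
exists g; split=> [|i]; last by case: (gP i).
apply: (occurrence_factor (host_occ k) (occurrence_comp (host_occ h) occF)).
by move=> i; case: (gP i).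
Qed.

Theorem theorem3p2 (X : permutation -> Prop) (hX : lwqo X) :
  lwqo (down_closure X).
Proof.
move=> L leL wqoL; split; first exact: labelled_le_preorder (proj1 wqoL).
move=> y; have [_ good] := hX _ _ (option_le_wqo wqoL).
pose h n := down_closure_hosted (lperm_in (y n)).
have [i [j [ltij leij]]] := good (fun n => host_labelled (h n)).
by exists i, j; split=> //; apply: host_labelled_le leij.
Qed.
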